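(* Let $C$ be a nonempty closed convex subset of a real Hilbert space $H$. Let $T:C\to C$ be a nonexpansive mapping and let $S:C\to C$ be a $k$-strictly pseudocontractive mapping, $0\le k<1$, such that $F(T)\cap F(S)\neq\emptyset$. Let $\{\lambda_n\}_{n\ge 0}\subset[a,b]$ for some $a,b\in(0,1-k)$ and $\{\alpha_n\}_{n\ge 0}\subset[c,d]$ for some $c,d\in(0,1)$. For an arbitrary initial value $x_0\in C$, let $\{x_n\}$ be the sequence defined by $$\begin{cases} y_n=\alpha_n x_n+(1-\alpha_n)\,T\big((1-\lambda_n)x_n+\lambda_n S x_n\big),\\ x_{n+1}=T\big((1-\lambda_n)y_n+\lambda_n S y_n\big),\end{cases}\qquad \forall n\ge 0.$$ Then the sequence $\{x_n\}$ converges weakly to a point $p\in F(T)\cap F(S)$, where $p=\lim_{n\to\infty}P_{F(T)\cap F(S)}\,x_n$.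
   Context: $\|\cdot\|$ denotes the norm of $H$ and $I$ the identity mapping. A mapping $T:C\to C$ is nonexpansive if $\|Tx-Ty\|\le\|x-y\|$ for all $x,y\in C$. A mapping $S:C\to C$ is $k$-strictly pseudocontractive (with $0\le k<1$) if $\|Sx-Sy\|^2\le\|x-y\|^2+k\|(I-S)x-(I-S)y\|^2$ for all $x,y\in C$. $F(T)=\{x\in C:Tx=x\}$ and $F(S)=\{x\in C:Sx=x\}$ are the fixed point sets. For a nonempty closed convex set $K\subset H$, $P_K:H\to K$ is the metric projection: $P_Kx$ is the unique point of $K$ with $\|x-P_Kx\|=\inf\{\|x-y\|:y\in K\}$. The limit of the projections is in the norm (strong) topology. *)

(* Defs.v *)
From HB Require Import structures.
From mathcomp Require Import all_boot all_order all_algebra sesquilinear.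
From mathcomp Require Import all_classical all_reals all_analysis.

Set Implicit Arguments.
Unset Strict Implicit.
Unset Printing Implicit Defensive.

Import Order.TTheory GRing.Theory Num.Theory.
Import numFieldNormedType.Exports.

Local Open Scope classical_set_scope.
Local Open Scope ring_scope.

(* A real Hilbert space is a complete normed module over [R] together with a
   symmetric positive definite bilinear form that induces its norm. *)
Definition is_inner_product (R : realType) (H : completeNormedModType R)
    (dot : {dot H for (idfun : R -> R)}) : Prop :=
  forall u : H, `|u| ^+ 2 = dot u u.

(* The mappings below act on [C] only: they are represented by total functions
   on [H], whose values outside [C] are never constrained. *)

Definition nonexpansive_on (R : realType) (H : normedModType R)
    (C : set H) (T : H -> H) : Prop :=
  forall x y, C x -> C y -> `|T x - T y| <= `|x - y|.

Definition strictly_pseudocontractive_on (R : realType) (H : normedModType R)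
    (k : R) (C : set H) (S : H -> H) : Prop :=
  forall x y, C x -> C y ->
    `|S x - S y| ^+ 2 <=
      `|x - y| ^+ 2 + k * `|(x - S x) - (y - S y)| ^+ 2.

Definition fixpoints_on (H : Type) (C : set H) (T : H -> H) : set H :=
  [set x | C x /\ T x = x].

(* When [K] is nonempty, closed and convex in a Hilbert space, exactly one point
   attains the infimum; the default value [0] only occurs when none does. *)
Definition metric_proj (R : realType) (H : normedModType R)
    (K : set H) (x : H) : H :=
  xget 0 [set z | K z /\ `|x - z| = inf [set `|x - y| | y in K]].

Definition weakly_cvg_to (R : realType) (H : normedModType R)
    (u : nat -> H) (p : H) : Prop :=
  forall f : {linear H -> R^o}, continuous f -> f (u n) @[n --> \oo] --> f p.

(* Main.v *)
Require Import Defs.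
From HB Require Import structures.
From mathcomp Require Import all_boot all_order all_algebra sesquilinear.
From mathcomp Require Import all_classical all_reals all_analysis.
From mathcomp Require Import ring lra.

Set Implicit Arguments.
Unset Strict Implicit.
Unset Printing Implicit Defensive.

Import Order.TTheory GRing.Theory Num.Theory.
Import numFieldNormedType.Exports.

Local Open Scope classical_set_scope.
Local Open Scope ring_scope.

(** For a common fixed point [z], each step satisfies
    [|x_{n+1} - z|^2 <= |x_n - z|^2 - del1 |x_n - S x_n|^2 - del2 |x_n - T w_n|^2]
    with [w_n = (1 - lambda_n) x_n + lambda_n S x_n].  Hence [x] is Fejer monotone
    with respect to the common fixed point set [K] and the residuals
    [x_n - T x_n] and [x_n - S x_n] tend to 0.  Since [G = (1 - a) I + a S] is
    nonexpansive with the same fixed points as [S], demiclosedness of nonexpansive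
    maps puts every weak cluster point of [x] in [K].  By Fejer monotonicity the
    projections [P_K x_n] form a Cauchy sequence, with limit [p], and a weak
    cluster point [q] in [K] satisfies [<x_n - P_K x_n, q - P_K x_n> <= 0], whence
    [q = p].  Weak cluster points are taken along ultrafilters: on a bounded
    sequence [h |-> lim_U <x_n, h>] exists and is a bounded linear form, so Riesz
    representation yields the weak limit without extracting subsequences. *)

(** * Limits along filters and ultrafilters *)

Lemma cvg_ultra (I : Type) (T : topologicalType) (F : set_system I)
    {FF : ProperFilter F} (f : I -> T) (l : T) :
  (forall U, UltraFilter U -> F `<=` U -> f i @[i --> U] --> l) ->
  f i @[i --> F] --> l.
Proof.
move=> Ucvg A Al; apply: contrapT => FA.
(* If the preimage of [A] is not in [F], then [F] restricted to its complement is proper; an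
   ultrafilter above it contains [F] and that complement, against convergence along it. *)
pose G := within (~` (f @^-1` A)) F.
have GF : ProperFilter G.
  apply: Build_ProperFilter.
  rewrite /G /within /= => F0; apply: FA.
  by apply: filterS F0 => i nAi; apply: contrapT => /nAi.
have [U [UU GU]] := ultraFilterLemma GF.
have FU : F `<=` U by move=> B FB; apply: GU; apply: filterS FB => i Bi _.
have UA : U (f @^-1` A) by exact: (Ucvg U UU FU).
have UnA : U (~` (f @^-1` A)) by apply: GU; exact: withinT.
by have := filterI UA UnA; rewrite setICr => U0; exact: (filter_not_empty U (U0 _)).
Qed.

Lemma fmap_ultra (I T : Type) (U : set_system I) (UU : UltraFilter U) (f : I -> T) :
  UltraFilter (f i @[i --> U]).
Proof.
apply: Build_UltraFilter => G GF UG; apply/seteqP; split=> // B GB.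
have [//|UnB] := in_ultra_setVsetC (f @^-1` B) UU.
have GnB : G (~` B) by apply: UG.
by have := filterI GB GnB; rewrite setICr => G0; case: (filter_not_empty G (G0 _)).
Qed.

(** The image ultrafilter contains the compact segment from [- M] to [M], hence converges. *)
Lemma cvg_ultra_bounded (R : realType) (I : Type) (U : set_system I)
    (UU : UltraFilter U) (f : I -> R) (M : R) :
  (forall i, `|f i| <= M) -> cvg (f i @[i --> U]).
Proof.
move=> fM.
have := @segment_compact R (- M) M; rewrite compact_ultra.
move=> /(_ _ (fmap_ultra UU f)) h.
have /h[l [_ fl]] : (f i @[i --> U]) `[- M, M]%classic.
  by apply: (@filterE _ U) => i /=; rewrite in_itv /= -ler_norml.
by apply/cvg_ex; exists l.
Qed.

Lemma cvgn_sqr_cauchy (R : realType) (V : completeNormedModType R)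
    (u : nat -> V) (e : nat -> R) :
  e n @[n --> \oo] --> 0 ->
  (forall n m, (n <= m)%N -> `|u n - u m| ^+ 2 <= e n) -> cvgn u.
Proof.
move=> e0 ue; apply/cauchy_cvgP/cauchy_exP => eps eps0.
have e20 : 0 < eps ^+ 2 by rewrite exprn_gt0.
have /cvgr0_norm_lt /(_ _ e20) [N _ /(_ N (leqnn N)) /= eN] := e0.
exists (u N); exists N => // m /= Nm.
rewrite -ball_normE /ball_ /=.
rewrite -(@ltr_pXn2r _ 2%N) ?nnegrE ?normr_ge0 1?ltW //.
by apply: le_lt_trans (ue _ _ Nm) _; exact: le_lt_trans (ler_norm _) eN.
Qed.

Lemma cvg0_sqr_le (R : realType) (I : Type) (F : set_system I) {FF : Filter F}
    (f e : I -> R) (t : R) :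
  0 < t -> (forall i, t * f i ^+ 2 <= e i) ->
  e i @[i --> F] --> 0 -> f i @[i --> F] --> 0.
Proof.
move=> t0 fe e0; apply/cvgr0Pnorm_lt => eps eps0.
have te0 : 0 < t * eps ^+ 2 by rewrite mulr_gt0 ?exprn_gt0.
move/cvgr0_norm_lt : e0 => /(_ _ te0); apply: filterS => i ei.
rewrite -(@ltr_pXn2r _ 2%N) ?nnegrE ?normr_ge0 1?ltW //.
rewrite real_normK ?num_real // -(ltr_pM2l t0).
by apply: le_lt_trans (fe i) _; apply: le_lt_trans (ler_norm _) ei.
Qed.

Lemma cvg_to_le (R : realType) (I : Type) (F : set_system I) {FF : ProperFilter F}
    (f : I -> R) (l c : R) :
  (forall i, f i <= c) -> f i @[i --> F] --> l -> l <= c.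
Proof.
move=> fc; apply: (@closed_cvg _ _ F _ f (fun s => s <= c)); first exact: closed_le.
exact: nearW.
Qed.

Lemma cvg_to_ge (R : realType) (I : Type) (F : set_system I) {FF : ProperFilter F}
    (f : I -> R) (l c : R) :
  (forall i, c <= f i) -> f i @[i --> F] --> l -> c <= l.
Proof.
move=> fc; apply: (@closed_cvg _ _ F _ f (fun s => c <= s)); first exact: closed_ge.
exact: nearW.
Qed.

(** [convex_set] quantifies over scalars typed in the unit interval; this form takes a real [t] with
    its bounds. *)
Lemma convex_setP (R : realType) (V : lmodType R) (K : set V) (p q : V) (t : R) :
  convex_set K -> K p -> K q -> 0 <= t <= 1 -> K (t *: p + (1 - t) *: q).
Proof.
move=> cK Kp Kq /andP[t0 t1].
have ti : Itv.spec (@Itv.num_sem R) (Itv.Real `[0%Z, 1%Z]) t.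
  by rewrite /Itv.spec /= /Itv.num_sem /= in_itv/= t0 t1 realE t0.
have := cK p q (Itv.mk ti).
by rewrite !inE; apply.
Qed.

(** * Inner product geometry, projections and Riesz representation *)

Section Hilbert.
Context (R : realType) (H : completeNormedModType R).
Context (dot : {dot H for (idfun : R -> R)}) (hdot : is_inner_product dot).
Implicit Types (u v w x z : H) (K : set H).

Lemma dotC u v : dot u v = dot v u.
Proof. by rewrite hermC /= expr0 mul1r. Qed.

Lemma dotDl u v w : dot (u + v) w = dot u w + dot v w.
Proof. exact: linearDl. Qed.

Lemma dotDr u v w : dot u (v + w) = dot u v + dot u w.
Proof. exact: linearDr. Qed.

Lemma dotZl t u v : dot (t *: u) v = t * dot u v.
Proof. exact: linearZl_LR. Qed.

Lemma dotZr t u v : dot u (t *: v) = t * dot u v.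
Proof. by rewrite dotC dotZl dotC. Qed.

Lemma dotNl u v : dot (- u) v = - dot u v.
Proof. by rewrite -scaleN1r dotZl mulN1r. Qed.

Lemma dotNr u v : dot u (- v) = - dot u v.
Proof. by rewrite dotC dotNl dotC. Qed.

Lemma dot0l u : dot 0 u = 0.
Proof. by rewrite -(scale0r 0) dotZl mul0r. Qed.

Definition dotE := (dotDl, dotDr, dotNl, dotNr, dotZl, dotZr).

Lemma normsqB u v : `|u - v| ^+ 2 = `|u| ^+ 2 - 2 * dot u v + `|v| ^+ 2.
Proof. rewrite !hdot !dotE (dotC v u); ring. Qed.

Lemma dot_le_norm u v : `|dot u v| <= `|u| * `|v|.
Proof.
have dle a b : dot a b <= `|a| * `|b|.
  have : `|a + b| ^+ 2 <= (`|a| + `|b|) ^+ 2.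
    by rewrite ler_sqr ?nnegrE ?addr_ge0 // ler_normD.
  rewrite sqrrD hdot !dotE (dotC b a) !hdot; lra.
by rewrite ler_norml dle andbT lerNl -dotNl -(normrN u) dle.
Qed.

(** At a midpoint this is the parallelogram law; the last term is the gain exploited for averaged
    maps and relaxed steps. *)
Lemma normsq_cvx t p q u :
  `|(t *: p + (1 - t) *: q) - u| ^+ 2 =
  t * `|p - u| ^+ 2 + (1 - t) * `|q - u| ^+ 2 - t * (1 - t) * `|p - q| ^+ 2.
Proof.
rewrite !hdot !dotE (dotC q p) (dotC u p) (dotC u q); ring.
Qed.

Lemma closest_dot_le0 K x z :
  convex_set K -> K z -> (forall w, K w -> `|x - z| ^+ 2 <= `|x - w| ^+ 2) ->
  forall w, K w -> dot (x - z) (w - z) <= 0.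
Proof.
move=> cK Kz zmin w Kw; rewrite leNgt; apply/negP.
set D := dot _ _ => D0; set N := `|w - z| ^+ 2.
have N0 : 0 <= N by rewrite exprn_ge0.
(* Moving from [z] towards [w] by [t] in (0,1], minimality gives [2 * D <= t * N]. This [t] also
   makes [t * N <= D], which contradicts [0 < D]. *)
pose t := D / (N + 1 + D).
have den : 0 < N + 1 + D by lra.
have t0 : 0 < t by rewrite divr_gt0.
have t1 : t <= 1 by rewrite ler_pdivrMr//; lra.
have := zmin _ (@convex_setP _ _ _ w z t cK Kw Kz _).
rewrite (ltW t0) t1 => /(_ isT).
have -> : x - (t *: w + (1 - t) *: z) = (x - z) - t *: (w - z).
  by rewrite scalerBl scale1r scalerBr addrCA opprD addrA.
rewrite (normsqB _ (t *: _)) dotZr normrZ exprMn gtr0_norm// -/D -/N => h.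
have : t * (2 * D) <= t * (t * N) by lra.
rewrite ler_pM2l // => h2.
have : t * N <= D by rewrite mulrAC ler_pdivrMr // ler_pM2l//; lra.
lra.
Qed.

(** A minimizing sequence is Cauchy: midpoints stay in [K], so the parallelogram law bounds
    [|w n - w m|^2] by twice the sum of the two excesses over [inf A], hence by [4 / (n + 1)] for
    [n <= m]. *)
Lemma closest_exists K x :
  closed K -> convex_set K -> K !=set0 ->
  exists2 z, K z & forall w, K w -> `|x - z| ^+ 2 <= `|x - w| ^+ 2.
Proof.
move=> clK cK [w0 Kw0].
pose A := [set `|x - w| ^+ 2 | w in K].
have Ainf : has_inf A.
  by split; [exists (`|x - w0| ^+ 2), w0 | exists 0 => _ [w _ <-]; exact: exprn_ge0].
have Aw w : K w -> inf A <= `|x - w| ^+ 2.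
  by move=> Kw; apply: ge_inf; [exact: Ainf.2 | exists w].
have wP n : {w | K w /\ `|x - w| ^+ 2 < inf A + n.+1%:R^-1}.
  apply: cid; have [|_ [w Kw <-] wn] := @inf_adherent _ A n.+1%:R^-1 _ Ainf.
    by rewrite invr_gt0.
  by exists w.
pose w n := sval (wP n).
have Kwn n : K (w n) by have [] := svalP (wP n).
have wn n : `|x - w n| ^+ 2 < inf A + n.+1%:R^-1 by have [] := svalP (wP n).
have inv0 : n.+1%:R^-1 @[n --> \oo] --> (0 : R) by exact: cvg_harmonic.
have wcvg : cvgn w.
  apply: (@cvgn_sqr_cauchy _ _ _ (fun n => 4 * n.+1%:R^-1)).
    by rewrite -(mulr0 4); apply: cvgM => //; exact: cvg_cst.
  move=> n m nm.
  have mn : (m.+1%:R^-1 <= n.+1%:R^-1 :> R) by rewrite lef_pV2 ?posrE// ler_nat.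
  have Kmid : K (2^-1 *: w n + (1 - 2^-1) *: w m).
    by apply: convex_setP => //; apply/andP; split; lra.
  have := Aw _ Kmid.
  rewrite distrC normsq_cvx ![`|w _ - x|]distrC.
  move: (wn n) (wn m) mn; move: n.+1%:R^-1 m.+1%:R^-1 => i j; lra.
exists (limn w).
  exact: (@closed_cvg _ _ \oo _ w K clK (nearW _ Kwn) _ wcvg).
move=> v Kv; apply: le_trans (Aw _ Kv).
rewrite -[leRHS]addr0.
apply: (@ler_cvg_to _ \oo _ R
  (fun n => `|x - w n| ^+ 2) (fun n => inf A + n.+1%:R^-1)).
- rewrite expr2; under eq_fun do rewrite expr2.
  by apply: cvgM; apply: cvg_norm; apply: cvgB => //; exact: cvg_cst.
- by apply: cvgD => //; exact: cvg_cst.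
- by apply: filterE => n; exact: ltW.
Qed.

Lemma metric_projP K x :
  closed K -> convex_set K -> K !=set0 ->
  K (metric_proj K x) /\
  forall w, K w -> dot (x - metric_proj K x) (w - metric_proj K x) <= 0.
Proof.
move=> clK cK K0.
have [z Kz zmin] := closest_exists x clK cK K0.
(* [metric_proj] minimizes distances, [closest_exists] squared ones; the point [z] attains both
   infima, so the default [0] of [xget] is not taken. *)
have zinf : `|x - z| = inf [set `|x - w| | w in K].
  apply/eqP; rewrite eq_le; apply/andP; split.
    apply: lb_le_inf => [|_ [w Kw <-]]; first by exists `|x - z|, z.
    by rewrite -ler_sqr ?nnegrE // zmin.
  by apply: ge_inf; [exists 0 => _ [w _ <-] | exists z].
have [KP Pinf] : K (metric_proj K x) /\
    `|x - metric_proj K x| = inf [set `|x - w| | w in K].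
  by apply: (@xgetPex H 0 [set z | K z /\ _]); exists z.
split=> //; apply: closest_dot_le0 => // w Kw.
by rewrite Pinf -zinf zmin.
Qed.

(** For nonzero [f], the projection [p] of 0 onto the hyperplane [f = 1] is orthogonal to the kernel
    of [f]; the representing vector is [p] divided by [dot p p]. *)
Lemma riesz (f : {linear H -> R^o}) :
  continuous f -> exists q, forall z, f z = dot q z.
Proof.
move=> fc; have [[e fe]|f0] := pselect (exists e, f e != 0); last first.
  exists 0 => z; rewrite dot0l; apply/eqP; apply: contrapT => /negP fz.
  by apply: f0; exists z.
pose K := [set z | f z = 1].
have clK : closed K.
  by apply: (@closed_comp _ _ f [set 1]) => [z _|]; [exact: fc | exact: closed_eq].
have cK : convex_set K.
  move=> u v t; rewrite !inE /K /= => fu fv.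
  by rewrite linearD !linearZ /= fu fv; rewrite /GRing.scale /= !mulr1 addrC subrK.
have K0 : K !=set0.
  by exists ((f e)^-1 *: e); rewrite /K /= linearZ /= /GRing.scale /= mulVf.
have [] := metric_projP 0 clK cK K0.
set p := metric_proj K 0 => fp pvar.
have ker h : f h = 0 -> dot p h = 0.
  move=> fh.
  (* Translating by both [h] and [- h] turns the variational inequality into an equality. *)
  have Kph t : K (p + t *: h).
    by rewrite /K /= linearD linearZ /= fh scaler0 addr0.
  have := pvar _ (Kph 1); have := pvar _ (Kph (- 1)).
  rewrite ![p + _]addrC !addrK sub0r !(dotNl, dotZr); lra.
have p0 : dot p p != 0.
  rewrite -hdot sqrf_eq0 normr_eq0; apply/eqP => p0.
  by move: fp; rewrite /K /= p0 linear0 => /esym/eqP; rewrite oner_eq0.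
exists ((dot p p)^-1 *: p) => z.
have := ker (z - f z *: p).
rewrite linearB linearZ /= fp /GRing.scale /= mulr1 subrr => /(_ erefl).
rewrite dotDr dotNr dotZr dotZl => /subr0_eq ->.
by rewrite mulrCA mulVf // mulr1.
Qed.

End Hilbert.

(** * Weak limits, demiclosedness and averaged maps *)

Section Nonexpansive.
Context (R : realType) (H : completeNormedModType R).
Context (dot : {dot H for (idfun : R -> R)}) (hdot : is_inner_product dot).
Implicit Types (u v w z p q : H) (K C : set H).

Lemma normsq_le0_eq (V : normedModType R) (u v : V) : `|u - v| ^+ 2 <= 0 -> u = v.
Proof.
move=> uv; apply/eqP; rewrite -subr_eq0 -normr_eq0 -sqrf_eq0.
by rewrite eq_le uv exprn_ge0.
Qed.

Lemma ultra_weak_limit (I : Type) (U : set_system I) (UU : UltraFilter U)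
    (x : I -> H) (M : R) :
  (forall i, `|x i| <= M) ->
  exists q, forall z, dot (x i) z @[i --> U] --> dot q z.
Proof.
move=> xM.
have dotxM i z : `|dot (x i) z| <= M * `|z|.
  by apply: le_trans (dot_le_norm hdot _ _) _; rewrite ler_wpM2r.
pose L z : R^o := lim (dot (x i) z @[i --> U]).
have Lcvg z : dot (x i) z @[i --> U] --> L z.
  by apply: cvg_ultra_bounded => i; exact: dotxM.
have Llin : linear L.
  move=> t u v; apply: cvg_lim => //.
  under eq_fun do rewrite dotDr dotZr.
  by apply: cvgD => //; apply: cvgM => //; exact: cvg_cst.
pose Llf : {linear H -> R^o} := HB.pack L (GRing.isLinear.Build R H R^o *:%R L Llin).
have Lc : continuous Llf.
  apply: bounded_linear_continuous; apply/linear_boundedP.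
  (* [M] bounds the norm of [L], since [|dot (x i) z| <= M * |z|] passes to the limit. *)
  near=> r => z /=.
  have rM : M <= r by near: r; by apply: nbhs_pinfty_ge; rewrite num_real.
  apply: le_trans (ler_wpM2r (normr_ge0 z) rM).
  by apply: (@cvg_to_le _ _ U _ (fun i => `|dot (x i) z|)) => //; exact: cvg_norm.
have [q Lq] := riesz hdot (f := Llf) Lc.
by exists q => z; rewrite -Lq; exact: Lcvg.
Unshelve. all: by end_near.
Qed.

(** With [P] the projection of [q], the inequality [dot (q - P) (x i - P) <= 0] passes to the weak
    limit and becomes [|q - P|^2 <= 0]. *)
Lemma weak_limit_closed_convex (I : Type) (F : set_system I) {FF : ProperFilter F}
    K (x : I -> H) q :
  closed K -> convex_set K -> (forall i, K (x i)) ->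
  (forall z, dot (x i) z @[i --> F] --> dot q z) -> K q.
Proof.
move=> clK cK Kx xq.
have [i0 _] := filter_ex (@filterT _ F _).
have [] := metric_projP hdot q clK cK (ex_intro _ _ (Kx i0)).
set P := metric_proj K q => KP Pvar.
have : dot (q - P) (q - P) <= 0.
  apply: (@cvg_to_le _ _ F _ (fun i => dot (q - P) (x i - P))) => [i|].
    exact: Pvar.
  rewrite dotDr; under eq_fun do rewrite dotDr.
  apply: cvgD; last exact: cvg_cst.
  by rewrite dotC; under eq_fun do rewrite dotC; exact: xq.
by rewrite -hdot => /normsq_le0_eq ->.
Qed.

Lemma nonexpansive_demiclosed (I : Type) (F : set_system I) {FF : ProperFilter F}
    C (N : H -> H) (x : I -> H) (M : R) q :
  nonexpansive_on C N -> C q -> (forall i, C (x i)) -> (forall i, `|x i| <= M) ->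
  `|x i - N (x i)| @[i --> F] --> 0 ->
  (forall z, dot (x i) z @[i --> F] --> dot q z) -> N q = q.
Proof.
move=> hN Cq Cx xM e0 xq.
pose e i := `|x i - N (x i)|.
(* Expanding [|x i - N q|^2] around [q] and using [|x i - N q| <= e i + |x i - q|] bounds
   [|q - N q|^2] by [B i]. The first term vanishes with the residual, the second by weak
   convergence. *)
pose B i := e i * (e i + 2 * (M + `|q|)) -
  2 * (dot (x i) (q - N q) - dot q (q - N q)).
have B0 : B i @[i --> F] --> 0.
  have -> : 0 = 0 * (0 + 2 * (M + `|q|)) -
    2 * (dot q (q - N q) - dot q (q - N q)) by ring.
  apply: cvgB.
    by apply: cvgM => //; apply: cvgD => //; exact: cvg_cst.
  by apply: cvgM; [exact: cvg_cst | apply: cvgB => //; exact: cvg_cst].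
have leB i : `|q - N q| ^+ 2 <= B i.
  have xNq : `|x i - N q| <= e i + `|x i - q|.
    have -> : x i - N q = (x i - N (x i)) + (N (x i) - N q) by rewrite addrA subrK.
    by apply: le_trans (ler_normD _ _) _; rewrite lerD2l; exact: hN.
  have xq' : `|x i - q| <= M + `|q|.
    by apply: le_trans (ler_normB _ _) _; rewrite lerD2r.
  have : `|x i - N q| ^+ 2 <= (e i + `|x i - q|) ^+ 2.
    by rewrite ler_sqr ?nnegrE // addr_ge0 // normr_ge0.
  have -> : `|x i - N q| ^+ 2 = `|x i - q| ^+ 2 +
      2 * (dot (x i) (q - N q) - dot q (q - N q)) + `|q - N q| ^+ 2.
    rewrite !hdot !(dotDl, dotDr, dotNl, dotNr).
    rewrite (dotC dot q (x i)) (dotC dot (N q) (x i)) (dotC dot (N q) q); ring.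
  have : e i * `|x i - q| <= e i * (M + `|q|) by rewrite ler_wpM2l // normr_ge0.
  rewrite /B; lra.
apply/esym/normsq_le0_eq.
exact: (@cvg_to_ge _ _ F _ B).
Qed.

Lemma fixpoints_closed C (N : H -> H) :
  closed C -> nonexpansive_on C N -> closed (fixpoints_on C N).
Proof.
move=> clC hN q clq.
have Cq : C q by apply: clC; apply: closure_subset clq => ? [].
split=> //; apply/eqP; rewrite -subr_eq0 -normr_le0; apply/ler_addgt0Pr => e e0.
have [z [[Cz Nz]]] := clq _ (nbhsx_ballx q (e / 2) (divr_gt0 e0 (ltr0n _ 2))).
rewrite -ball_normE /= => qz; rewrite add0r.
have -> : N q - q = (N q - N z) + (z - q) by rewrite Nz addrA subrK.
apply: le_trans (ler_normD _ _) _.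
have := hN _ _ Cq Cz; rewrite [`|z - q|]distrC; lra.
Qed.

(** Apply [normsq_cvx] at [m] and at [N m]: moving from [m] to [N m] increases neither distance to
    [p] and [q], while the weighted sum of their squares grows by exactly [|m - N m|^2]. *)
Lemma fixpoints_convex C (N : H -> H) :
  convex_set C -> nonexpansive_on C N -> convex_set (fixpoints_on C N).
Proof.
move=> cC hN p q t; rewrite !inE => -[Cp Np] [Cq Nq].
set m := conv _ _ _.
have Cm : C m by have := cC p q t; rewrite !inE; apply.
split=> //.
have [t0 t1] : 0 <= t%:num /\ t%:num <= 1 by [].
have mE : m = t%:num *: p + (1 - t%:num) *: q by [].
apply/esym/normsq_le0_eq.
have hsq z : C z -> N z = z -> `|z - N m| ^+ 2 <= `|z - m| ^+ 2.
  by move=> Cz Nz; rewrite ler_sqr ?nnegrE // -{1}Nz; exact: hN.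
have := normsq_cvx hdot t%:num p q m; rewrite -mE subrr normr0 expr0n /= => m0.
rewrite {1}mE (normsq_cvx hdot).
have := ler_wpM2l t0 (hsq _ Cp Np).
have : (1 - t%:num) * `|q - N m| ^+ 2 <= (1 - t%:num) * `|q - m| ^+ 2.
  by rewrite ler_wpM2l ?subr_ge0 //; exact: hsq.
lra.
Qed.

(** In [normsq_cvx] for [S u - S v] and [u - v], the residual term has coefficient [- t * (1 - t)];
    pseudocontractivity adds [t * k], leaving [- t * (1 - k - t)]. *)
Lemma averaged_strictly_pseudocontractive C (S : H -> H) (k t : R) u v :
  strictly_pseudocontractive_on k C S -> 0 <= t -> C u -> C v ->
  `|((1 - t) *: u + t *: S u) - ((1 - t) *: v + t *: S v)| ^+ 2 <=
    `|u - v| ^+ 2 - t * (1 - k - t) * `|(u - S u) - (v - S v)| ^+ 2.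
Proof.
move=> hS t0 Cu Cv.
have := ler_wpM2l t0 (hS _ _ Cu Cv).
have := normsq_cvx hdot t (S u - S v) (u - v) 0.
have -> : t *: (S u - S v) + (1 - t) *: (u - v) - 0 =
    (1 - t) *: u + t *: S u - ((1 - t) *: v + t *: S v).
  by rewrite subr0 !scalerBr opprD addrC addrACA.
move=> ->; rewrite !subr0.
have -> : S u - S v - (u - v) = - ((u - S u) - (v - S v)).
  by rewrite !opprB addrACA [RHS]addrACA [S u + v]addrC.
rewrite normrN; lra.
Qed.

Lemma averaged_nonexpansive C (S : H -> H) (k t : R) :
  strictly_pseudocontractive_on k C S -> 0 <= t <= 1 - k ->
  nonexpansive_on C (fun u => (1 - t) *: u + t *: S u).
Proof.
move=> hS /andP[t0 tk] u v Cu Cv.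
rewrite -ler_sqr ?nnegrE //.
apply: le_trans (averaged_strictly_pseudocontractive hS t0 Cu Cv) _.
by rewrite gerBl mulr_ge0 ?exprn_ge0 // mulr_ge0 //; lra.
Qed.

Lemma averaged_fixpoints C (S : H -> H) (t : R) : t != 0 ->
  fixpoints_on C (fun u => (1 - t) *: u + t *: S u) = fixpoints_on C S.
Proof.
move=> t0; apply/seteqP; split=> u [Cu Su]; split=> //; last first.
  by rewrite Su -scalerDl subrK scale1r.
apply: (scalerI t0); apply/eqP; rewrite -subr_eq0; apply/eqP.
apply: (@addrI _ u); rewrite addr0 [_ - t *: u]addrC addrA.
by move: Su; rewrite scalerBl scale1r.
Qed.

(** * Fejer monotone sequences and the half-step estimate *)

Lemma fejer_cvg K (x : nat -> H) :
  closed K -> convex_set K -> K !=set0 ->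
  (forall p, K p -> forall n, `|x n.+1 - p| <= `|x n - p|) ->
  cvgn (fun n => metric_proj K (x n)).
Proof.
move=> clK cK K0 xK.
set u := fun n => _.
have uP n : K (u n) /\ forall w, K w -> dot (x n - u n) (w - u n) <= 0.
  exact: metric_projP.
have xKm p : K p -> forall n m, (n <= m)%N -> `|x m - p| ^+ 2 <= `|x n - p| ^+ 2.
  move=> Kp n m nm; rewrite ler_sqr ?nnegrE //.
  elim: m nm => [|m IH]; first by rewrite leqn0 => /eqP ->.
  by rewrite leq_eqVlt => /orP[/eqP -> //|/IH]; apply: le_trans; exact: xK.
pose g n := `|x n - u n| ^+ 2.
(* Testing the variational inequality at [u m] against [u n] gives
   [|u n - u m|^2 <= |x m - u n|^2 - g m], and Fejer monotonicity bounds [|x m - u n|^2] by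
   [g n]. *)
have gu n m : (n <= m)%N -> `|u n - u m| ^+ 2 <= g n - g m.
  move=> nm; have [Kn _] := uP n; have [_ /(_ _ Kn)] := uP m.
  have := xKm _ Kn n m nm.
  have -> : x m - u n = (x m - u m) - (u n - u m) by rewrite opprB addrA subrK.
  rewrite (normsqB hdot (x m - u m)) -/(g n) -/(g m); lra.
have gcvg : cvgn g.
  apply: nonincreasing_is_cvgn.
    by move=> n m nm; rewrite -subr_ge0; apply: le_trans (gu _ _ nm); exact: exprn_ge0.
  by exists 0 => _ [n _ <-]; exact: exprn_ge0.
apply: (@cvgn_sqr_cauchy _ _ _ (fun n => g n - limn g)).
  by rewrite -(subrr (limn g)); apply: cvgB => //; exact: cvg_cst.
move=> n m nm; apply: le_trans (gu _ _ nm) _; rewrite lerD2l lerN2.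
apply: nonincreasing_cvgn_ge => // i j ij.
by rewrite -subr_ge0; apply: le_trans (gu _ _ ij); exact: exprn_ge0.
Qed.

Lemma fejer_weak_cvg K (x : nat -> H) :
  closed K -> convex_set K -> K !=set0 ->
  (forall p, K p -> forall n, `|x n.+1 - p| <= `|x n - p|) ->
  (forall U q, UltraFilter U -> \oo `<=` U ->
    (forall z, dot (x n) z @[n --> U] --> dot q z) -> K q) ->
  exists p, [/\ K p, forall z, dot (x n) z @[n --> \oo] --> dot p z &
    metric_proj K (x n) @[n --> \oo] --> p].
Proof.
move=> clK cK K0 xK xcl.
have ucvg := fejer_cvg clK cK K0 xK.
pose u n := metric_proj K (x n).
have uP n : K (u n) /\ forall w, K w -> dot (x n - u n) (w - u n) <= 0.
  exact: metric_projP.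
set p := lim _ in ucvg.
have Kp : K p.
  exact: (@closed_cvg _ _ \oo _ u K clK (nearW _ (fun n => (uP n).1)) _ ucvg).
have xpM n : `|x n - p| <= `|x 0%N - p|.
  by elim: n => // n; apply: le_trans; exact: xK.
have xM n : `|x n| <= `|x 0%N - p| + `|p|.
  rewrite -[x n](subrK p); apply: le_trans (ler_normD _ _) _.
  by rewrite lerD2r.
exists p; split=> // z.
apply: cvg_ultra => U UU ooU.
have [q xq] := ultra_weak_limit UU xM.
have Kq : K q by exact: xcl UU ooU xq.
suff -> : p = q by exact: xq.
have up0 : `|u n - p| @[n --> \oo] --> 0.
  rewrite -(normr0 H) -(subrr p); apply: cvg_norm; apply: cvgB => //; exact: cvg_cst.
have up0U : `|u n - p| @[n --> U] --> 0 by move=> A /up0; exact: ooU.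
pose M := `|x 0%N - p| + `|q - p|.
pose B n := dot q (q - p) - dot (x n) (q - p) + M * `|u n - p|.
(* Split [q - p] as [(q - x n) + (x n - u n) + (u n - p)] and pair it with [q - p]. The variational
   inequality at [q] bounds the middle pairing by [dot (x n - u n) (u n - p)]; Cauchy-Schwarz then
   gives the factor [M]. *)
have qpB n : `|q - p| ^+ 2 <= B n.
  have [_ uvar] := uP n.
  have xu : `|x n - u n| <= `|x 0%N - p|.
    apply: le_trans (xpM n); rewrite -ler_sqr ?nnegrE //.
    have -> : x n - p = (x n - u n) - (p - u n) by rewrite opprB addrA subrK.
    rewrite (normsqB hdot (x n - u n)).
    by have := uvar _ Kp; have := exprn_ge0 2 (normr_ge0 (p - u n)); lra.
  have := uvar _ Kq.
  have := le_trans (ler_norm _) (dot_le_norm hdot (x n - u n) (u n - p)).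
  have := le_trans (ler_norm _) (dot_le_norm hdot (u n - p) (q - p)).
  have := ler_wpM2r (normr_ge0 (u n - p)) xu.
  rewrite /B /M hdot !(dotDl, dotDr, dotNl, dotNr).
  rewrite (dotC dot p q); lra.
have B0 : B n @[n --> U] --> 0.
  have -> : 0 = dot q (q - p) - dot q (q - p) + M * 0 by ring.
  by apply: cvgD; [apply: cvgB => // | apply: cvgM => //]; exact: cvg_cst.
by apply/esym/normsq_le0_eq; exact: (@cvg_to_ge _ _ U _ B).
Qed.

(** Serves both halves of the iteration: with [u] the current iterate, the last bound controls
    [y n]; with [u] equal to [y n], the third controls the next iterate. The point [p] has zero
    residual under [S], so only that of [u] remains. *)
Lemma normsq_step C (T S : H -> H) (k l t : R) u v p :
  convex_set C -> nonexpansive_on C T -> strictly_pseudocontractive_on k C S ->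
  set_fun C C T -> set_fun C C S -> 0 <= k -> 0 <= l <= 1 - k -> 0 <= t <= 1 ->
  C u -> (fixpoints_on C T `&` fixpoints_on C S) p ->
  v = t *: u + (1 - t) *: T ((1 - l) *: u + l *: S u) ->
  [/\ C v, C (T ((1 - l) *: u + l *: S u)),
    `|T ((1 - l) *: u + l *: S u) - p| ^+ 2 <=
       `|u - p| ^+ 2 - l * (1 - k - l) * `|u - S u| ^+ 2 &
    `|v - p| ^+ 2 <= `|u - p| ^+ 2 - (1 - t) * (l * (1 - k - l)) * `|u - S u| ^+ 2
      - t * (1 - t) * `|u - T ((1 - l) *: u + l *: S u)| ^+ 2].
Proof.
move=> cC hT hS TC SC k0 /andP[l0 lk] t01 Cu [[Cp Tp] [_ Sp]] ->.
have l01 : 0 <= 1 - l <= 1 by lra.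
have CW w : C w -> C ((1 - l) *: w + l *: S w).
  move=> Cw; have := convex_setP cC Cw (SC _ Cw) l01.
  by rewrite subKr.
set w := _ + l *: S u; have Cw : C w by exact: CW.
have CTw : C (T w) by exact: TC.
have Wp : (1 - l) *: p + l *: S p = p by rewrite Sp -scalerDl subrK scale1r.
have TwP : `|T w - p| ^+ 2 <= `|u - p| ^+ 2 - l * (1 - k - l) * `|u - S u| ^+ 2.
  have := averaged_strictly_pseudocontractive hS l0 Cu Cp.
  rewrite Wp -/w Sp subrr subr0; apply: le_trans.
  by rewrite ler_sqr ?nnegrE // -{1}Tp; exact: hT.
split=> //; first exact: convex_setP.
rewrite (normsq_cvx hdot).
have /andP[t0 t1] := t01.
have : (1 - t) * `|T w - p| ^+ 2 <=
    (1 - t) * (`|u - p| ^+ 2 - l * (1 - k - l) * `|u - S u| ^+ 2).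
  by rewrite ler_wpM2l ?subr_ge0.
lra.
Qed.

End Nonexpansive.

(** * Convergence of the iteration *)

Theorem theorem3 (R : realType) (H : completeNormedModType R)
    (dot : {dot H for (idfun : R -> R)}) (hdot : is_inner_product dot)
    (C : set H) (C0 : C !=set0) (Cclosed : closed C) (Cconvex : convex_set C)
    (T : {fun C >-> C}) (hT : nonexpansive_on C T)
    (k : R) (k0 : 0 <= k) (k1 : k < 1)
    (S : {fun C >-> C}) (hS : strictly_pseudocontractive_on k C S)
    (hF : fixpoints_on C T `&` fixpoints_on C S !=set0)
    (a b : R) (ha : 0 < a < 1 - k) (hb : 0 < b < 1 - k)
    (lambda : nat -> R) (hlambda : forall n, a <= lambda n <= b)
    (c d : R) (hc : 0 < c < 1) (hd : 0 < d < 1)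
    (alpha : nat -> R) (halpha : forall n, c <= alpha n <= d)
    (x y : nat -> H) (hx0 : C (x 0%N))
    (hy : forall n, y n = alpha n *: x n
       + (1 - alpha n) *: T ((1 - lambda n) *: x n + lambda n *: S (x n)))
    (hx : forall n,
       x n.+1 = T ((1 - lambda n) *: y n + lambda n *: S (y n))) :
  exists p : H,
    [/\ (fixpoints_on C T `&` fixpoints_on C S) p,
        weakly_cvg_to x p &
        metric_proj (fixpoints_on C T `&` fixpoints_on C S) (x n)
          @[n --> \oo] --> p].
Proof.
have [/andP[a0 ak] /andP[b0 bk]] := conj ha hb.
have [/andP[c0 c1] /andP[d0 d1]] := conj hc hd.
have la n : a <= lambda n /\ lambda n <= b by apply/andP.
have al n : c <= alpha n /\ alpha n <= d by apply/andP.
set K := fixpoints_on C T `&` fixpoints_on C S.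
pose G u := (1 - a) *: u + a *: S u.
have hG : nonexpansive_on C G.
  by apply: (averaged_nonexpansive hdot hS); rewrite !ltW.
have GS : fixpoints_on C G = fixpoints_on C S.
  by apply: averaged_fixpoints; rewrite gt_eqF.
(* Closedness and convexity of fixed point sets are available for nonexpansive maps, hence the
   passage from [S] to [G]. *)
have clK : closed K by rewrite /K -GS; apply: closedI; exact: fixpoints_closed.
have cK : convex_set K.
  move=> p q t; rewrite /K -GS !inE => -[p1 p2] [q1 q2].
  have := fixpoints_convex hdot Cconvex hT t (mem_set p1) (mem_set q1).
  have := fixpoints_convex hdot Cconvex hG t (mem_set p2) (mem_set q2).
  by rewrite !inE.
have l01 n : 0 <= lambda n <= 1 - k by have := la n; lra.
have al01 n : 0 <= alpha n <= 1 by have := al n; lra.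
pose w n := (1 - lambda n) *: x n + lambda n *: S (x n).
have half n u v p := @normsq_step R H dot hdot C T S k (lambda n) (alpha n) u v p
  Cconvex hT hS (@funS _ _ _ _ T) (@funS _ _ _ _ S) k0 (l01 n) (al01 n).
have [p0 Kp0] := hF.
have Cx n : C (x n).
  elim: n => // n Cx; rewrite hx.
  have [Cy _ _ _] := half n _ _ _ Cx Kp0 (hy n).
  by have [_ ? _ _] := half n _ _ _ Cy Kp0 erefl.
(* The bounds on [alpha n] and [lambda n] make [del1] and [del2] lower bounds, uniform in [n], for
   the gains of the first half step. *)
pose del1 := (1 - d) * (a * (1 - k - b)).
have del10 : 0 < del1 by rewrite !mulr_gt0 //; lra.
pose del2 := c * (1 - d).
have del20 : 0 < del2 by rewrite !mulr_gt0 //; lra.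
have step p n : K p -> `|x n.+1 - p| ^+ 2 <= `|x n - p| ^+ 2
    - del1 * `|x n - S (x n)| ^+ 2 - del2 * `|x n - T (w n)| ^+ 2.
  move=> Kp.
  have [Cy _ _ yp] := half n _ _ _ (Cx n) Kp (hy n).
  have [_ _ xp _] := half n _ _ _ Cy Kp erefl.
  have [lan lnb] := la n; have [can and] := al n.
  (* The second half step enters only through the sign of its gain. *)
  have h0 : 0 <= lambda n * (1 - k - lambda n) * `|y n - S (y n)| ^+ 2.
    by rewrite !mulr_ge0 ?exprn_ge0 //; lra.
  have h1 : del1 * `|x n - S (x n)| ^+ 2 <=
      (1 - alpha n) * (lambda n * (1 - k - lambda n)) * `|x n - S (x n)| ^+ 2.
    rewrite ler_wpM2r ?exprn_ge0 // !ler_pM //; try lra; rewrite mulr_ge0 //; lra.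
  have h2 : del2 * `|x n - T (w n)| ^+ 2 <=
      alpha n * (1 - alpha n) * `|x n - T (w n)| ^+ 2.
    rewrite ler_wpM2r ?exprn_ge0 // !ler_pM //; lra.
  rewrite hx; apply: le_trans xp _; move: yp h0 h1 h2; rewrite -/(w n); lra.
have sqge0 n : 0 <= del1 * `|x n - S (x n)| ^+ 2 /\ 0 <= del2 * `|x n - T (w n)| ^+ 2.
  by split; rewrite mulr_ge0 ?exprn_ge0 // ltW.
have fejer p : K p -> forall n, `|x n.+1 - p| <= `|x n - p|.
  move=> Kp n; rewrite -ler_sqr ?nnegrE //.
  by have := step p n Kp; have := sqge0 n; lra.
have xM n : `|x n| <= `|x 0%N - p0| + `|p0|.
  rewrite -[x n](subrK p0); apply: le_trans (ler_normD _ _) _; rewrite lerD2r.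
  by elim: n => // n; apply: le_trans; exact: fejer.
(* Consecutive differences of a convergent sequence; by [step], they dominate both scaled squared
   residuals. *)
pose e n := `|x n - p0| ^+ 2 - `|x n.+1 - p0| ^+ 2.
have e0 : e n @[n --> \oo] --> 0.
  pose g n := `|x n - p0| ^+ 2.
  have gcvg : cvgn g.
    apply: nonincreasing_is_cvgn; last by exists 0 => _ [n _ <-]; exact: exprn_ge0.
    by apply/nonincreasing_seqP => n; rewrite /g ler_sqr ?nnegrE //; exact: fejer.
  rewrite -(subrr (limn g)); apply: cvgB => //.
  by rewrite (cvg_shiftS g).
have res0 : `|x n - S (x n)| @[n --> \oo] --> 0.
  apply: (cvg0_sqr_le del10 _ e0) => n.
  by have := step p0 n Kp0; have := sqge0 n; rewrite /e; lra.
have resW0 : `|x n - T (w n)| @[n --> \oo] --> 0.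
  apply: (cvg0_sqr_le del20 _ e0) => n.
  by have := step p0 n Kp0; have := sqge0 n; rewrite /e; lra.
have resT0 : `|x n - T (x n)| @[n --> \oo] --> 0.
  (* Nonexpansiveness of [T] gives [|T (w n) - T (x n)| <= |w n - x n|], which equals
     [lambda n * |x n - S (x n)|], and [lambda n <= 1]. *)
  apply: (@squeeze_cvgr _ _ _ _ (fun=> 0)
    (fun n => `|x n - T (w n)| + `|x n - S (x n)|)).
  - apply: nearW => n; rewrite normr_ge0 /=.
    have -> : x n - T (x n) = (x n - T (w n)) + (T (w n) - T (x n)).
      by rewrite addrA subrK.
    apply: le_trans (ler_normD _ _) _; rewrite lerD2l.
    have Cw : C (w n).
      have := convex_setP Cconvex (Cx n) (@funS _ _ _ _ S _ (Cx n)) (t := 1 - lambda n).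
      by rewrite subKr; apply; have := l01 n; lra.
    apply: le_trans (hT _ _ Cw (Cx n)) _.
    have -> : w n - x n = lambda n *: (S (x n) - x n).
      rewrite /w scalerBl scale1r scalerBr addrAC [_ - _ - x n]addrAC.
      by rewrite subrr add0r addrC.
    rewrite normrZ distrC ger0_norm; last by have := l01 n; lra.
    by rewrite ler_piMl //; have := l01 n; lra.
  - exact: cvg_cst.
  - by rewrite -(addr0 0); apply: cvgD.
have resG0 : `|x n - G (x n)| @[n --> \oo] --> 0.
  have -> : (fun n => `|x n - G (x n)|) = (fun n => a * `|x n - S (x n)|).
    apply/funext => n; rewrite -{1}(gtr0_norm a0) -normrZ; congr `|_|.
    by rewrite /G scalerBl scale1r scalerBr opprD opprB addrA addrCA subrr addr0.
  by rewrite -(mulr0 a); apply: cvgM => //; exact: cvg_cst.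
have [|p [Kp xp up]] := fejer_weak_cvg hdot clK cK hF fejer.
  move=> U q UU ooU xq.
  (* Membership in [C] comes first, because [T] and [G] are nonexpansive only on [C]. *)
  have Cq : C q by exact: (weak_limit_closed_convex hdot Cclosed Cconvex Cx xq).
  have Tq : T q = q.
    apply: (nonexpansive_demiclosed hdot hT Cq Cx xM _ xq).
    by move=> A /resT0; exact: ooU.
  have Gq : G q = q.
    apply: (nonexpansive_demiclosed hdot hG Cq Cx xM _ xq).
    by move=> A /resG0; exact: ooU.
  by rewrite /K -GS; split.
exists p; split=> // f fc.
(* Riesz representation reduces an arbitrary continuous functional to a pairing with [g]. *)
have [g fg] := riesz hdot fc.
rewrite fg; under eq_fun do rewrite fg dotC.
by rewrite dotC; exact: xp.
Qed.
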